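(* Let $G$ be a group and let $X$ be an infinite transitive $G$-space. Then there exists a $G$-selective ultrafilter $\mathcal{U}$ on $X$.
   Context: A $G$-space is a set $X$ with an action $G\times X\to X$, $(g,x)\mapsto gx$, of the group $G$; it is transitive if for any $x,y\in X$ there exists $g\in G$ with $gx=y$. A partition $\mathcal{P}$ of $X$ is $G$-invariant if $gP\in\mathcal{P}$ for all $g\in G$ and $P\in\mathcal{P}$. An ultrafilter is free if it is non-principal. A free ultrafilter $\mathcal{U}$ on an infinite $G$-space $X$ is $G$-selective if, for every $G$-invariant partition $\mathcal{P}$ of $X$, either some cell of $\mathcal{P}$ is a member of $\mathcal{U}$, or there exists $U\in\mathcal{U}$ such that $|P\cap U|\leqslant 1$ for each $P\in\mathcal{P}$. The result is a theorem of ZFC, with no additional set-theoretic assumptions. *)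

(* Defs.v *)
From HB Require Import structures.
From mathcomp Require Import all_boot.
From mathcomp Require Import all_classical.

Set Implicit Arguments.
Unset Strict Implicit.
Unset Printing Implicit Defensive.

Local Open Scope classical_set_scope.

(* [groupType] places no finiteness assumption on G, and its choiceType
   structure is available on every type in the presence of [boolp]. *)
Record gSpace (G : groupType) := GSpace {
  gspace_sort :> Type;
  gact : G -> gspace_sort -> gspace_sort;
  gact1 : forall x, gact 1%g x = x;
  gactM : forall g h x, gact (g * h)%g x = gact g (gact h x)
}.

Section GSpaceTheory.
Variables (G : groupType) (X : gSpace G).

Definition gtransitive : Prop := forall x y : X, exists g : G, gact g x = y.

Definition set_partition (P : set (set X)) : Prop := partition P id [set: X].

Definition ginvariant (P : set (set X)) : Prop :=
  forall (g : G) (A : set X), P A -> P (gact g @` A).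

Definition free_ultrafilter (U : set_system X) : Prop :=
  UltraFilter U /\ ~ exists x : X, U = principal_filter x.

Definition gselective (U : set_system X) : Prop :=
  free_ultrafilter U /\
  forall P : set (set X), set_partition P -> ginvariant P ->
    (exists2 A, P A & U A) \/
    (exists2 B, U B & forall A, P A -> (A `&` B #<= `I_1)%card).

End GSpaceTheory.

Arguments gtransitive {G} X.

(* Main.v *)
(** Fix a point x0. The cells of invariant partitions that contain x0 are
    blocks, and blocks at x0 are closed under finite intersection. Zorn's lemma
    gives a maximal family M of infinite blocks closed under finite
    intersection; let U be an ultrafilter containing M and all cofinite sets.
    For an invariant partition with cell A at x0, either A is in M, hence in U,
    or A meets some B in M in a finite set. In the latter case, by transitivity,
    every cell that meets B meets it in a translate of the finite set A `&` B,
    so B is covered by finitely many partial transversals of the partition, and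
    one of these is in U. *)

Require Import Defs.
From mathcomp Require Import all_boot.
From mathcomp Require Import all_classical.

Set Implicit Arguments.
Unset Strict Implicit.

Local Open Scope classical_set_scope.

(** If [A] meets every member of a maximal [M] in an infinite set, adjoining the traces of [A] on
    the members of [M] keeps closure and infiniteness. Maximality then puts these traces into [M],
    among them [A], its own trace on [setT]. *)
Lemma maximal_infinite_setI_closed (T : Type) (K : set_system T) :
  infinite_set [set: T] -> K setT -> setI_closed K ->
  exists M : set_system T,
    [/\ M `<=` K, M setT, setI_closed M, forall B, M B -> infinite_set B &
        forall A, K A -> M A \/ exists2 B, M B & finite_set (A `&` B)].
Proof.
move=> Tinf KT KI.
(* The condition [M setT] is left out because the union of the empty chain must be good; maximality
   restores it. *)
pose good (M : set_system T) :=
  [/\ M `<=` K, setI_closed M & forall B, M B -> infinite_set B].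
have [F Fgood Ftot|M [[MK MI Minf] Mmax]] := Zorn_bigcup (P := good).
  split=> [B [N FN NB]|A B [N FN NA] [N' FN' N'B]|B [N FN NB]].
  - by have [+ _ _] := Fgood _ FN; apply.
  - have [NN'|N'N] := Ftot _ _ FN FN'.
      by exists N' => //; have [_ + _] := Fgood _ FN'; apply=> //; exact: NN'.
    by exists N => //; have [_ + _] := Fgood _ FN; apply=> //; exact: N'N.
  - by have [_ _ +] := Fgood _ FN; apply.
have maxM N : M `<=` N -> good N -> N `<=` M.
  move=> MN goodN; apply: contrapT => NM; exact: (Mmax N).
have MT : M setT.
  apply: (maxM (M `|` [set setT])); [exact: subsetUl| |by right].
  split=> [B [/MK//|->//]|A B [MA|->] [MB|->]|B [/Minf//|->//]].
  - by left; exact: MI.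
  - by rewrite setIT; left.
  - by rewrite setTI; left.
  - by rewrite setTI; right.
exists M; split=> // A KA.
have [|noB] := pselect (exists2 B, M B & finite_set (A `&` B)); first by right.
left; apply: (maxM (M `|` [set A `&` B | B in M])); first exact: subsetUl.
  split.
  - by move=> _ [/MK//|[B MB <-]]; exact: KI (MK _ MB).
  + move=> C D [MC|[B MB <-]] [MD|[B' MB' <-]].
    * by left; exact: MI.
    * by right; exists (C `&` B'); [exact: MI|rewrite setICA].
    * by right; exists (B `&` D); [exact: MI|rewrite setIA].
    * by right; exists (B `&` B'); [exact: MI|rewrite setIACA setIid].
  + by move=> _ [/Minf//|[B MB <-]] finAB; apply: noB; exists B.
- by right; exists setT => //; rewrite setIT.
Qed.

(** Members of [M] with finite sets removed are nonempty and closed under intersection, so they form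
    a base of a proper filter. *)
Lemma cofinite_ultrafilter_extension (T : Type) (M : set_system T) :
  M setT -> setI_closed M -> (forall B, M B -> infinite_set B) ->
  exists U : set_system T, [/\ UltraFilter U, M `<=` U &
    forall E, finite_set E -> U (~` E)].
Proof.
move=> MT MI Minf.
pose D (BE : set T * set T) := M BE.1 /\ finite_set BE.2.
pose F := filter_from D (fun BE => BE.1 `\` BE.2).
have F_proper : ProperFilter F.
  apply: filter_from_proper => [|[B E] [/= MB finE]].
    apply: filter_from_filter => [|[B E] [B' E'] [/= MB finE] [/= MB' finE']].
      by exists (setT, set0); split=> //=; exact: finite_set0.
    exists (B `&` B', E `|` E'); first by split; [exact: MI|rewrite finite_setU].
    by move=> x [[Bx B'x]] /= /not_orP[Ex E'x].
  by apply/infinite_setN0/infinite_setD => //; exact: Minf.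
have [U [ultraU FU]] := ultraFilterLemma F_proper.
exists U; split=> // [B MB|E finE]; apply: FU.
  by exists (B, set0) => [|x []//]; split=> //=; exact: finite_set0.
by exists (setT, E) => [|x []//].
Qed.

Lemma ultra_bigcup_finite (T I : Type) (U : set_system T) (E : set I)
    (D : I -> set T) :
  UltraFilter U -> finite_set E -> U (\bigcup_(i in E) D i) ->
  exists2 i, E i & U (D i).
Proof.
move=> ultraU finE UD; apply: contrapT => noD.
have [E' EE'] := (@finite_fsetP {classic I} E).1 finE.
have UC : U (\bigcap_(i in E) ~` D i).
  rewrite EE'; apply: (@filter_bigI _ {classic I}) => i iE'.
  have [UDi|//] := in_ultra_setVsetC (D i) ultraU.
  by case: noD; exists i => //; rewrite EE'.
have [x [[i Ei Dix]]] := filter_ex (filterI UD UC).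
by move=> /(_ _ Ei).
Qed.

Section Blocks.
Variables (G : groupType) (X : gSpace G).
Implicit Types (g : G) (x : X) (A B C : set X).

Lemma gactK g : cancel (@gact G X g) (gact g^-1%g).
Proof. by move=> x; rewrite -gactM mulVg gact1. Qed.

(** Any [g] that moves [x0] within [B] stabilizes [B]. For a transitive action these are the usual
    blocks containing [x0]; testing translates of [x0] alone makes closure under intersection
    immediate. *)
Definition block_at x0 : set_system X :=
  [set B | B x0 /\ forall g, B (gact g x0) -> forall x, B (gact g x) <-> B x].

Lemma block_atT x0 : block_at x0 setT.
Proof. by []. Qed.

Lemma block_atI x0 : setI_closed (block_at x0).
Proof.
move=> A B [Ax0 Ablock] [Bx0 Bblock]; split=> // g [Agx0 Bgx0] x.
by split=> -[Ax Bx]; split; apply/(Ablock _ Agx0) || apply/(Bblock _ Bgx0).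
Qed.

Lemma partition_cell_ex (P : set (set X)) x :
  set_partition P -> exists2 A, P A & A x.
Proof.
by move=> [Pcov _ _]; have : [set: X] x by []; rewrite -Pcov.
Qed.

Lemma partition_cell_eq (P : set (set X)) A B x :
  set_partition P -> P A -> P B -> A x -> B x -> A = B.
Proof. by move=> [_ Ptriv _] PA PB Ax Bx; apply: Ptriv => //; exists x. Qed.

Lemma ginvariant_cell_translate (P : set (set X)) A C g x :
  set_partition P -> ginvariant P -> P A -> P C -> A x -> C (gact g x) ->
  C = gact g @` A.
Proof.
move=> Ppart Pinv PA PC Ax Cgx; have PgA := Pinv g A PA.
by apply: (partition_cell_eq Ppart PC PgA Cgx); exists x.
Qed.

(** If [g] moves [x0] within [A], then the translate of [A] by [g] is a cell meeting [A], hence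
    equal to [A]. *)
Lemma ginvariant_cell_block (P : set (set X)) A x0 :
  set_partition P -> ginvariant P -> P A -> A x0 -> block_at x0 A.
Proof.
move=> Ppart Pinv PA Ax0; split=> // g Agx0 x.
have AE := ginvariant_cell_translate Ppart Pinv PA PA Ax0 Agx0.
split=> [|Ax]; last by rewrite AE; exists x.
by rewrite {1}AE => -[y Ay /(can_inj (gactK g)) <-].
Qed.

Lemma finite_block_transversal (U : set_system X) (P : set (set X)) A B x0 :
  gtransitive X -> UltraFilter U -> set_partition P -> ginvariant P ->
  P A -> A x0 -> block_at x0 B -> U B -> finite_set (A `&` B) ->
  exists2 D, U D & forall C, P C -> (C `&` D #<= `I_1)%card.
Proof.
move=> Xtrans ultraU Ppart Pinv PA Ax0 [_ Bblock] UB finAB.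
(* [s C] carries [x0] into both [C] and [B]; the default [1] arises only for sets [C] disjoint from
   [B]. Each [D a] takes at most the point [gact (s C) a] from a cell [C]. *)
pose s C : G := xget 1%g [set g | C (gact g x0) /\ B (gact g x0)].
pose D a := [set y | exists C, [/\ P C, C y & y = gact (s C) a]].
have [|a _ UDa] := @ultra_bigcup_finite _ _ U _ D ultraU finAB.
  apply: filterS UB => y By.
  have [C PC Cy] := partition_cell_ex y Ppart.
  have [Csx0 Bsx0] : C (gact (s C) x0) /\ B (gact (s C) x0).
    apply: (@xgetPex _ 1%g [set g | C (gact g x0) /\ B (gact g x0)]).
    by have [g gx0] := Xtrans x0 y; exists g; rewrite /= gx0.
  have CE := ginvariant_cell_translate Ppart Pinv PA PC Ax0 Csx0.
  move: (Cy); rewrite {1}CE => -[a Aa ay].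
  exists a; last by exists C.
  (* As [s C] moves [x0] within [B], it stabilizes [B], so [y] in [B] forces [a] in [B]. *)
  by split=> //; apply/(Bblock _ Bsx0); rewrite ay.
exists (D a) => // C PC; rewrite -(card_le_eqr (card_set1 (x := gact (s C) a))).
apply: subset_card_le => y [Cy [C' [PC' C'y ->]]].
by rewrite /= (partition_cell_eq Ppart PC PC' Cy C'y).
Qed.

End Blocks.

Theorem theorem1 (G : groupType) (X : gSpace G)
    (Xinf : infinite_set [set: X]) (Xtrans : gtransitive X) :
  exists U : set_system X, gselective U.
Proof.
have [x0 _] := infinite_setN0 Xinf.
have [M [MK MT MI Minf Mmax]] :=
  maximal_infinite_setI_closed Xinf (block_atT x0) (@block_atI _ _ x0).
have [U [ultraU MU Ucofin]] := cofinite_ultrafilter_extension MT MI Minf.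
exists U; split.
  (* An ultrafilter principal at [x] cannot contain the cofinite complement of [x]. *)
  split=> // -[x Ux]; have := Ucofin [set x] (finite_set1 x).
  by rewrite Ux => /principal_filterP; apply.
move=> P Ppart Pinv.
have [A PA Ax0] := partition_cell_ex x0 Ppart.
have [MA|[B MB finAB]] := Mmax A (ginvariant_cell_block Ppart Pinv PA Ax0).
  by left; exists A => //; exact: MU.
right; exact: finite_block_transversal Ax0 (MK _ MB) (MU _ MB) finAB.
Qed.
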